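(* The planar knotoid invariant $K\mapsto B_K(x,v)$ (where $B_K=B_D$ for any diagram $D$ of the planar knotoid $K$) is a Vassiliev invariant of order $1$.
   Context: **Knotoid diagrams.** A planar knotoid diagram $D$ is a generic immersion $f:[0,1]\to\mathbb{R}^2$ (its only multiple points are finitely many transverse double points, called crossings, distinct from $f(0)$ and $f(1)$) with over/under information at each crossing; it is oriented from its leg $f(0)$ to its head $f(1)$. $C(D)$ is the set of crossings. The sign $\mathrm{sgn}(c)$ is $+1$ if (tangent of overstrand, tangent of understrand) is a positively oriented basis of $\mathbb{R}^2$, and $-1$ otherwise. Two diagrams are equivalent if they are related by finitely many planar isotopies and oriented Reidemeister moves performed away from the leg and the head; equivalence classes are planar knotoids. **Coloring number.** The arcs of $D$ are the closures of the components of $D\setminus C(D)$. A Cheng coloring assigns an integer to each arc so that, travelling along $D$, at each passage through a crossing (over or under) the label increases by $1$ if the curve crosses the other strand from right to left (with respect to that other strand's orientation) and decreases by $1$ if from left to right. It is unique up to an additive constant. At a crossing $c$, let $a$ be the label of the incoming arc of the strand crossing the other one from right to left (its outgoing arc has label $a+1$), and $b$ the label of the outgoing arc of the other strand (its incoming arc has label $b+1$). Then $u(c)=a-b$. **Gauss diagram and $B$-function.** $G(D)$ is the interval $[0,1]$ drawn as a counterclockwise oriented arc of a circle (with a gap between head and leg), with one chord for each crossing $c$ (also denoted $c$) joining its two preimages and oriented from the over-preimage to the under-preimage. For a chord $c$, $r(c)$ (resp. $l(c)$) is the set of chords $e$ crossing $c$ and pointing to the right (resp. left) hand side of $c$. The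 degree is $d(c)=\sum_{e\in r(c)}\mathrm{sgn}(e)-\sum_{e\in l(c)}\mathrm{sgn}(e)$. Let $R_m=\mathbb{Z}[v,v^{-1}]/(v^m-1)$ for $m\ge0$. The map $\phi_c:\mathbb{Z}\to\{0,1,\dots,|d(c)|-1\}$ is reduction modulo $|d(c)|$ (the identity of $\mathbb{Z}$ if $d(c)=0$). In $R_{|d(c)|}$ put $g_c(v)=\sum_{e\in r(c)}\mathrm{sgn}(e)v^{\phi_c(d(e))}-\sum_{e\in l(c)}\mathrm{sgn}(e)v^{\phi_c(-d(e))}$, and $B_D(x,v)=\sum_{c\in C(D)}u(c)x^{g_c(v)}$, an element of the free abelian group on formal symbols $x^p$ with $p\in\bigsqcup_{m\ge0}R_m$. It is a planar knotoid invariant. **Vassiliev invariants.** A singular planar knotoid diagram is a planar knotoid diagram in which finitely many crossings are singular, i.e. carry no over/under information (and are marked by a dot). Singular planar knotoids are classes of such diagrams modulo oriented Reidemeister moves, singular Reidemeister moves and planar isotopies. Every planar knotoid invariant $\nu$ with values in an abelian group extends to singular planar knotoids by the Vassiliev skein relation $\nu(D(c))=\nu(D(c^+))-\nu(D(c^-))$, applied at each singular crossing $c$ in turn, where $D(c^+)$ and $D(c^-)$ are obtained from the diagram $D(c)$ by replacing the singular crossing $c$ by a positive and a negative crossing respectively. $\nu$ is a Vassiliev invariant of order $n$ if $\nu(K)\neq0$ for some singular planar knotoid $K$ with $n$ singular crossings and $\nu(K)=0$ for every singular planar knotoid $K$ with more than $n$ singular crossings. *)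

(* Defs.v *)
From HB Require Import structures.
From Stdlib Require Import Relation_Operators.
From mathcomp Require Import all_boot all_order all_algebra.
From mathcomp Require Import generic_quotient ring_quotient ring finmap freeg.
From mathcomp Require Import all_classical all_reals all_analysis.

Set Implicit Arguments.
Unset Strict Implicit.
Unset Printing Implicit Defensive.

Import Order.TTheory GRing.Theory Num.Theory.
Import numFieldNormedType.Exports.

Local Open Scope classical_set_scope.
Local Open Scope quotient_scope.
Local Open Scope ring_scope.

(** * The rings R_m and the group of values *)

(* Z[v, v^-1] is presented as Z[v, w] / (v w - 1): in {poly {poly int}} the
   inner variable 'X%:P is v and the outer variable 'X is w = v^-1.  Hence
   R_m = Z[v, v^-1] / (v^m - 1) is Z[v, w] / (v w - 1, v^m - 1); for m = 0 the
   second generator is 0 and R_0 = Z[v, v^-1]. *)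
Definition Rm_ideal (m : nat) : {poly {poly int}} -> bool := fun p =>
  `[< exists q r : {poly {poly int}},
      p = q * ('X%:P * 'X - 1) + r * ('X%:P ^+ m - 1) >].

Lemma Rm_ideal_closed m : idealr_closed (Rm_ideal m).
Proof.
split.
- by apply/asboolP; exists 0, 0; rewrite !mul0r addr0.
- apply/asboolPn => -[q [r]].
  move=> /(congr1 (fun p : {poly {poly int}} => p.[1].[1])).
  by rewrite !(hornerE, expr1n, subrr, mulr0, addr0) => /eqP; rewrite oner_eq0.
- move=> a p p' /asboolP[q [r ->]] /asboolP[q' [r' ->]]; apply/asboolP.
  by exists (a * q + q'), (a * r + r'); ring.
Qed.

HB.instance Definition _ m := isIdealr.Build _ (Rm_ideal m) (Rm_ideal_closed m).

Definition Rm_idealr (m : nat) : idealr {poly {poly int}} := Rm_ideal m.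

Definition Rm (m : nat) : Type := {ideal_quot (Rm_idealr m)}.
HB.instance Definition _ m := GRing.ComNzRing.on (Rm m).
HB.instance Definition _ m := Quotient.on (Rm m).

Definition vpow (m : nat) (k : int) : Rm m :=
  match k with
  | Posz n => \pi_(Rm m) ('X%:P ^+ n)
  | Negz n => \pi_(Rm m) ('X ^+ n.+1)
  end.

(* The free abelian group on the symbols x^p, p in the disjoint union of the
   R_m; the symbol x^p with p in R_m is Tagged Rm p. *)
Definition exponent : Type := {m : nat & Rm m}.
HB.instance Definition _ := Choice.on exponent.

Definition value_group : zmodType := {freeg exponent / int}.

(** * Generic immersions *)

Section Curves.
Variable R : realType.
Implicit Types (gamma : R -> R * R) (c e : R * R).

Definition det (a b : R * R) : R := a.1 * b.2 - a.2 * b.1.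

Definition velocity gamma (t : R) : R * R :=
  ((fst \o gamma)^`()%classic t, (snd \o gamma)^`()%classic t).

(* p and q are the two preimages of a multiple point; p is the parameter of
   the passage under consideration, q that of the other strand. *)
Definition passage gamma (p q : R) : Prop :=
  [/\ 0 <= p <= 1, 0 <= q <= 1, p != q & gamma p = gamma q].

(* A crossing is the pair of its preimages in increasing order. *)
Definition crossings gamma : set (R * R) :=
  [set c | passage gamma c.1 c.2 /\ c.1 < c.2].

(* Curves are total functions, but only their restriction to [0, 1] matters:
   a smooth map on [0, 1] is the restriction of a smooth map on the line. *)
Record generic_immersion gamma : Prop := GenericImmersion {
  immersion_smooth : forall n t,
    derivable (derive1n n (fst \o gamma)) t 1 /\
    derivable (derive1n n (snd \o gamma)) t 1;
  immersion_regular : forall t : R, 0 <= t <= 1 -> velocity gamma t != 0;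
  immersion_finite : finite_set (crossings gamma);
  immersion_double : forall p q q',
    passage gamma p q -> passage gamma p q' -> q = q';
  immersion_transverse : forall p q,
    passage gamma p q -> det (velocity gamma p) (velocity gamma q) != 0;
  immersion_ends : forall p q, passage gamma p q -> 0 < p < 1
}.

(** * Cheng colorings *)

(* +1 if, at its passage p, the curve crosses the strand through q from right
   to left, -1 if from left to right. *)
Definition turn gamma (p q : R) : int :=
  if 0 < det (velocity gamma q) (velocity gamma p) then 1 else -1.

(* A labelling of the arcs is given as a function of the parameter: k t is the
   label of the arc containing gamma t, and, when t is the parameter of a
   passage, the label of the arc arriving there. *)
Definition cheng_coloring gamma (k : R -> int) : Prop :=
  (forall s t : R, 0 <= s -> s <= t -> t <= 1 ->
     (forall p q, passage gamma p q -> ~~ (s <= p < t)) -> k t = k s) /\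
  (forall p q t, passage gamma p q -> p < t -> t <= 1 ->
     (forall p' q', passage gamma p' q' -> ~~ (p < p' < t)) ->
     k t = k p + turn gamma p q).

(* A chosen Cheng coloring; u does not depend on the choice. *)
Definition coloring gamma : R -> int := xget (fun=> 0) (cheng_coloring gamma).

Definition u gamma c : int :=
  let: (p, q) := if turn gamma c.1 c.2 == 1 then (c.1, c.2) else (c.2, c.1) in
  let a := coloring gamma p in
  let b := coloring gamma q + turn gamma q p in
  a - b.

End Curves.

(** * Knotoid diagrams *)

(* FirstOver: the passage with the smaller parameter is the over-passage. *)
Inductive crossing_kind := FirstOver | SecondOver | Singular.

Definition swap_kind (k : crossing_kind) : crossing_kind :=
  match k with
  | FirstOver => SecondOver
  | SecondOver => FirstOver
  | Singular => Singular
  end.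

(* Only the values of [kind] on the crossings of [curve] matter. *)
Record singular_diagram (R : realType) := SingularDiagram {
  curve : R -> R * R;
  kind : R * R -> crossing_kind;
  curve_generic : generic_immersion curve
}.

Record diagram (R : realType) := Diagram {
  sdiagram :> singular_diagram R;
  diagram_nonsingular :
    forall c, crossings (curve sdiagram) c -> kind sdiagram c <> Singular
}.

(** * Gauss diagram and B-function *)

Section BFunction.
Variables (R : realType) (D : diagram R).
Implicit Types c e : R * R.

Definition over_par c : R := if kind D c is FirstOver then c.1 else c.2.
Definition under_par c : R := if kind D c is FirstOver then c.2 else c.1.

Definition sgn c : int :=
  if 0 < det (velocity (curve D) (over_par c)) (velocity (curve D) (under_par c))
  then 1 else -1.

(* [0, 1] is a counterclockwise arc, so the points at the right of the chord c
   are those met on the circle when going counterclockwise from the tail of c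
   (its over-preimage) to its head (its under-preimage). *)
Definition right_of c (t : R) : bool :=
  let: (o, n) := (over_par c, under_par c) in
  if o < n then o < t < n else (o < t) || (t < n).
Definition left_of c (t : R) : bool :=
  let: (o, n) := (over_par c, under_par c) in
  if o < n then (n < t) || (t < o) else n < t < o.

Definition r_set c : set (R * R) :=
  [set e | [/\ crossings (curve D) e, left_of c (over_par e)
             & right_of c (under_par e)]].
Definition l_set c : set (R * R) :=
  [set e | [/\ crossings (curve D) e, right_of c (over_par e)
             & left_of c (under_par e)]].

Definition degree c : int :=
  \sum_(e \in r_set c) sgn e - \sum_(e \in l_set c) sgn e.

Definition phi c (k : int) : int := (k %% `|degree c|)%Z.

Definition g c : Rm `|degree c| :=
  \sum_(e \in r_set c) (vpow `|degree c| (phi c (degree e)) *~ sgn e)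
  - \sum_(e \in l_set c) (vpow `|degree c| (phi c (- degree e)) *~ sgn e).

Definition B : value_group :=
  \sum_(c \in crossings (curve D)) << u (curve D) c *g Tagged Rm (g c) >>.

End BFunction.

(** * Equivalence of (singular) diagrams *)

Section Moves.
Variable R : realType.
Implicit Types (D : singular_diagram R) (w : seq (R * R)) (U : set (R * R)).

Definition homeomorphism (h : R * R -> R * R) : Prop :=
  continuous h /\ exists h', [/\ continuous h', cancel h h' & cancel h' h].

(* D' is the image of D under an ambient isotopy H of the plane, up to an
   orientation-preserving reparametrization f. *)
Definition planar_isotopy D D' : Prop :=
  exists (H : R -> R * R -> R * R) (f : R -> R),
    [/\ continuous (fun x : R * (R * R) => H x.1 x.2),
        forall s, homeomorphism (H s) & H 0 =1 id] /\
    [/\ continuous f, {homo f : s t / s < t}, f 0 = 0, f 1 = 1 &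
        (forall t : R, 0 <= t <= 1 -> curve D' (f t) = H 1 (curve D t)) /\
        (forall c, crossings (curve D) c ->
           kind D' (f c.1, f c.2) = kind D c)].

Definition closed_disk U : Prop :=
  exists2 h, homeomorphism h & U = h @` [set x | x.1 ^+ 2 + x.2 ^+ 2 <= 1].

Definition in_open w (t : R) : bool := has (fun I => I.1 < t < I.2) w.
Definition in_closed w (t : R) : bool := has (fun I => I.1 <= t <= I.2) w.

(* The diagram meets the disk U in the strands parametrized by the intervals
   [I.1, I.2], I in w, which are properly embedded at their ends. *)
Definition meets_disk U w D : Prop := forall t : R, 0 <= t <= 1 ->
  (in_open w t -> interior U (curve D t)) /\
  (~~ in_closed w t -> ~ U (curve D t)).

(* D and D' coincide outside a disk that contains neither the leg nor the head
   and meets both diagrams in the same strands, listed in increasing order of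
   the parameter. *)
Definition local_move w D D' : Prop :=
  path <%R 0 (rcons (flatten [seq [:: ab.1; ab.2] | ab <- w]) 1) /\
  exists U, [/\ closed_disk U, meets_disk U w D, meets_disk U w D',
    (forall t : R, 0 <= t <= 1 -> ~~ in_open w t -> curve D t = curve D' t) &
    (forall c, crossings (curve D) c -> ~~ in_closed w c.1 ->
       kind D c = kind D' c)].

Definition local_crossings w D : set (R * R) :=
  [set c | crossings (curve D) c /\ in_closed w c.1].

(* The crossing c is between the strands I and J. *)
Definition between (I J c : R * R) : Prop :=
  I.1 < c.1 < I.2 /\ J.1 < c.2 < J.2.

(* Moves are described by the crossings of the strands in the disk; up to
   planar isotopy these determine the strands, given their end points. *)

(* An embedded strand is replaced by a strand with a single crossing. *)
Definition reidemeister1 D D' : Prop := exists I c,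
  [/\ local_move [:: I] D D', local_crossings [:: I] D = set0,
      local_crossings [:: I] D' = [set c], between I I c
    & kind D' c <> Singular].

(* Two disjoint strands are replaced by two strands with two crossings, one of
   the strands being over the other at both. *)
Definition reidemeister2 D D' : Prop := exists I J c1 c2,
  [/\ local_move [:: I; J] D D', local_crossings [:: I; J] D = set0,
      local_crossings [:: I; J] D' = [set c1; c2] &
      [/\ c1 != c2, between I J c1, between I J c2,
          kind D' c1 = kind D' c2 & kind D' c1 <> Singular]].

Definition triangle (I1 I2 I3 c12 c13 c23 : R * R) D : Prop :=
  local_crossings [:: I1; I2; I3] D = [set c12; c13; c23] /\
  [/\ between I1 I2 c12, between I1 I3 c13 & between I2 I3 c23].

(* One of the three strands passes over both others, or under both others;
   their mutual crossing is arbitrary.  When it is real this is the usual third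
   move; when it is singular, the singular move in which a strand passes over
   or under a singular crossing. *)
Definition reidemeister3 D D' : Prop := exists I1 I2 I3 c12 c13 c23 c12' c13' c23',
  [/\ local_move [:: I1; I2; I3] D D',
      triangle I1 I2 I3 c12 c13 c23 D, triangle I1 I2 I3 c12' c13' c23' D',
      [/\ kind D' c12' = kind D c12, kind D' c13' = kind D c13
        & kind D' c23' = kind D c23] &
      [\/ kind D c12 = kind D c13 /\ kind D c12 <> Singular,
          kind D c12 = swap_kind (kind D c23) /\ kind D c12 <> Singular
        | kind D c13 = kind D c23 /\ kind D c13 <> Singular]].

(* A singular and a real crossing of the same two strands are exchanged.  The
   sign of the real crossing is kept; since the two crossings have opposite
   directions this means that the over-strand changes. *)
Definition singular_twist D D' : Prop := exists I J c1 c2 c1' c2',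
  [/\ local_move [:: I; J] D D',
      local_crossings [:: I; J] D = [set c1; c2],
      local_crossings [:: I; J] D' = [set c1'; c2'],
      [/\ between I J c1, between I J c2, between I J c1' & between I J c2'] &
      [/\ c1.1 < c2.1 /\ c1'.1 < c2'.1, kind D c1 = Singular,
          kind D c2 <> Singular, kind D' c1' = swap_kind (kind D c2)
        & kind D' c2' = Singular]].

Definition move D D' : Prop :=
  [\/ planar_isotopy D D', reidemeister1 D D', reidemeister2 D D'
    | reidemeister3 D D'].

Definition singular_move D D' : Prop := move D D' \/ singular_twist D D'.

End Moves.

Section Generated.
Variables (T : Type) (r : T -> T -> Prop).

Definition generated : rel T := fun x y => `[< clos_refl_sym_trans T r x y >].

Lemma generated_refl : reflexive generated.
Proof. by move=> x; apply/asboolP; exact: rst_refl. Qed.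

Lemma generated_sym : symmetric generated.
Proof. by move=> x y; apply/asboolP/asboolP => ?; exact: rst_sym. Qed.

Lemma generated_trans : transitive generated.
Proof.
by move=> y x z /asboolP xy /asboolP yz; apply/asboolP; exact: rst_trans xy yz.
Qed.

Canonical generated_equiv :=
  EquivRel generated generated_refl generated_sym generated_trans.

End Generated.

HB.instance Definition _ (R : realType) := gen_eqMixin (diagram R).
HB.instance Definition _ (R : realType) := gen_choiceMixin (diagram R).
HB.instance Definition _ (R : realType) := gen_eqMixin (singular_diagram R).
HB.instance Definition _ (R : realType) := gen_choiceMixin (singular_diagram R).

Definition equiv_diagram (R : realType) : rel (diagram R) :=
  generated (fun D D' : diagram R => move D D').
Canonical equiv_diagram_equiv (R : realType) :=
  EquivRel (@equiv_diagram R) (@generated_refl _ _) (@generated_sym _ _)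
    (@generated_trans _ _).

Definition equiv_singular (R : realType) : rel (singular_diagram R) :=
  generated (@singular_move R).
Canonical equiv_singular_equiv (R : realType) :=
  EquivRel (@equiv_singular R) (@generated_refl _ _) (@generated_sym _ _)
    (@generated_trans _ _).

Definition knotoid (R : realType) : Type := {eq_quot (@equiv_diagram R)}.
HB.instance Definition _ (R : realType) := Quotient.on (knotoid R).

Definition singular_knotoid (R : realType) : Type :=
  {eq_quot (@equiv_singular R)}.
HB.instance Definition _ (R : realType) := Quotient.on (singular_knotoid R).

(** * Vassiliev invariants *)

Section Vassiliev.
Variables (R : realType) (A : zmodType).
Implicit Types D : singular_diagram R.

Definition singular_crossings D : set (R * R) :=
  [set c | crossings (curve D) c /\ kind D c = Singular].

Definition nb_singular D : nat := #|` fset_set (singular_crossings D)|.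

(* D(c+) for s = true and D(c-) for s = false: with the first passage over,
   the sign of c is that of the determinant. *)
Definition resolve D (c : R * R) (s : bool) : singular_diagram R :=
  @SingularDiagram R (curve D)
    (fun c' => if c' == c then
       if (0 < det (velocity (curve D) c.1) (velocity (curve D) c.2)) == s
       then FirstOver else SecondOver
     else kind D c')
    (curve_generic D).

Definition skein_extension (nu : knotoid R -> A)
    (nu_sing : singular_diagram R -> A) : Prop :=
  (forall D : diagram R, nu_sing D = nu (\pi_(knotoid R) D)) /\
  (forall D c, singular_crossings D c ->
     nu_sing D = nu_sing (resolve D c true) - nu_sing (resolve D c false)).

(* The skein relation determines nu_sing; the value of the extension and the
   number of singular crossings of K are those of the diagrams representing K. *)
Definition vassiliev_of_order (nu : knotoid R -> A) (n : nat) : Prop :=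
  exists2 nu_sing, skein_extension nu nu_sing &
    (exists K : singular_knotoid R, exists D,
       [/\ \pi_(singular_knotoid R) D = K, nb_singular D = n
         & nu_sing D <> 0]) /\
    (forall (K : singular_knotoid R) D,
       \pi_(singular_knotoid R) D = K -> (n < nb_singular D)%N ->
       nu_sing D = 0).

End Vassiliev.

(* Main.v *)
(* Swapping over and under at a chord e moves e from the right to the left of
   every chord c that it crosses and changes its sign, its degree becoming
   -d(e); both d(c) and g_c(v) are therefore unchanged.  Hence x^(g_c) depends
   only on the curve and on the over/under information at c, and B is a sum over
   the crossings of terms depending only on the information at one of them.
   Second differences of such a sum vanish.  A first difference does not: in a
   diagram with exactly two crossings whose chords are interlaced, u(c) is
   nonzero while g_c, an element of R_1 = Z, changes from -1 to 1 when c is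
   switched. *)

Require Import Defs.
From mathcomp Require Import all_boot all_order all_algebra.
From mathcomp Require Import generic_quotient ring_quotient ring lra finmap freeg.
From mathcomp Require Import all_classical all_reals all_analysis.

Set Implicit Arguments.
Unset Strict Implicit.
Unset Printing Implicit Defensive.

Import Order.TTheory GRing.Theory Num.Theory.
Import numFieldNormedType.Exports.

Local Open Scope classical_set_scope.
Local Open Scope ring_scope.

(** * Crossing changes: tangent signs and sides of a chord *)

(** [Singular] is grouped with [SecondOver], the default branch of [over_par] and [under_par]; the
    function is thus total on singular diagrams. *)
Definition first_over (R : realType) (D : singular_diagram R) (c : R * R) : bool :=
  if kind D c is FirstOver then true else false.

Lemma over_parE (R : realType) (D : diagram R) c :
  over_par D c = if first_over D c then c.1 else c.2.
Proof. by rewrite /over_par /first_over; case: (kind D c). Qed.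

Lemma under_parE (R : realType) (D : diagram R) c :
  under_par D c = if first_over D c then c.2 else c.1.
Proof. by rewrite /under_par /first_over; case: (kind D c). Qed.

Lemma over_under_same (R : realType) (D D' : diagram R) c :
  first_over D c = first_over D' c ->
  over_par D c = over_par D' c /\ under_par D c = under_par D' c.
Proof. by rewrite !over_parE !under_parE => ->. Qed.

Lemma over_under_swap (R : realType) (D D' : diagram R) c :
  first_over D c != first_over D' c ->
  over_par D c = under_par D' c /\ under_par D c = over_par D' c.
Proof. by rewrite !over_parE !under_parE; do 2!case: ifP. Qed.

Lemma over_neq_under (R : realType) (D : diagram R) c :
  crossings (curve D) c -> over_par D c != under_par D c.
Proof.
by move=> [_ c12]; rewrite over_parE under_parE;
  case: ifP => _; rewrite ?(lt_eqF c12) ?(gt_eqF c12).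
Qed.

Lemma det_antisym (R : realType) (a b : R * R) : det b a = - det a b.
Proof. by rewrite /det; ring. Qed.

Lemma det_over_under_neq0 (R : realType) (D : diagram R) c :
  crossings (curve D) c ->
  det (velocity (curve D) (over_par D c)) (velocity (curve D) (under_par D c)) != 0.
Proof.
move=> [pc _]; have := immersion_transverse (curve_generic D) pc.
by rewrite over_parE under_parE; case: ifP => // _; rewrite det_antisym oppr_eq0.
Qed.

Lemma sgn_same (R : realType) (D D' : diagram R) c : curve D = curve D' ->
  first_over D c = first_over D' c -> sgn D' c = sgn D c.
Proof.
by move=> eq_curve /over_under_same [eo eu]; rewrite /sgn -eq_curve -eo -eu.
Qed.

Lemma sgn_swap (R : realType) (D D' : diagram R) c : curve D = curve D' ->
  crossings (curve D) c -> first_over D c != first_over D' c ->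
  sgn D' c = - sgn D c.
Proof.
move=> eq_curve cD /over_under_swap [eo eu]; have := det_over_under_neq0 cD.
rewrite /sgn -eq_curve -eo -eu [X in 0 < X]det_antisym oppr_gt0.
(* By transversality the determinant is nonzero; at 0 both signs would be -1. *)
by case: ltgtP.
Qed.

Lemma sides_same (R : realType) (D D' : diagram R) c t :
  first_over D c = first_over D' c ->
  right_of D' c t = right_of D c t /\ left_of D' c t = left_of D c t.
Proof.
by move=> /over_under_same [eo eu]; rewrite /right_of /left_of -eo -eu.
Qed.

Lemma sides_swap (R : realType) (D D' : diagram R) c t :
  crossings (curve D) c -> first_over D c != first_over D' c ->
  right_of D' c t = left_of D c t /\ left_of D' c t = right_of D c t.
Proof.
move=> /over_neq_under ou /over_under_swap [eo eu].
by rewrite /right_of /left_of -eo -eu; case: ltgtP ou.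
Qed.

(** * Degrees and exponents as signed sums over all chords *)

(* [degree] and [g] are both signed sums of this form: F weighs the chords
   pointing to the right of c and G those pointing to its left. *)
Definition chord_term (R : realType) (V : zmodType) (D : diagram R) (c : R * R)
    (F G : R * R -> V) (e : R * R) : V :=
  if left_of D c (over_par D e) && right_of D c (under_par D e)
  then F e *~ sgn D e
  else if right_of D c (over_par D e) && left_of D c (under_par D e)
  then - (G e *~ sgn D e) else 0.

Lemma left_right_disjoint (R : realType) (D : diagram R) c t :
  left_of D c t -> right_of D c t -> False.
Proof.
rewrite /left_of /right_of; case: ltP => _.
  by case/orP=> lt1 /andP[lt2 lt3]; lra.
by case/andP=> lt1 lt2 /orP[]; lra.
Qed.

(** The two sides of c are disjoint, so no chord is in both r(c) and l(c), and the nested tests of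
    [chord_term] lose nothing. The new index set depends on the curve alone. *)
Lemma chord_sumE (R : realType) (V : zmodType) (D : diagram R) c
    (F G : R * R -> V) :
  \sum_(e \in r_set D c) (F e *~ sgn D e) - \sum_(e \in l_set D c) (G e *~ sgn D e)
  = \sum_(e \in crossings (curve D)) chord_term D c F G e.
Proof.
have finX := immersion_finite (curve_generic D).
set r := fun e => left_of D c (over_par D e) && right_of D c (under_par D e).
set l := fun e => right_of D c (over_par D e) && left_of D c (under_par D e).
have -> : r_set D c = crossings (curve D) `&` [set e | r e].
  by apply/seteqP; split => e /=; [move=> [? ? ?]; split=> //; apply/andP
    | move=> [? /andP[]]].
have -> : l_set D c = crossings (curve D) `&` [set e | l e].
  by apply/seteqP; split => e /=; [move=> [? ? ?]; split=> //; apply/andP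
    | move=> [? /andP[]]].
move: (crossings (curve D)) finX => X finX.
rewrite !fsbig_mkcondr !fsbig_finite// -sumrB; apply: eq_bigr => e _.
have mem_pred (a : pred (R * R)) : (e \in [set x | a x]) = a e.
  by apply/idP/idP; rewrite inE.
rewrite !mem_pred /chord_term -/(r e) -/(l e).
case: ifP => [/andP[re _]|_]; last by rewrite sub0r; case: ifP; rewrite ?oppr0.
by case: ifP => [/andP[/(left_right_disjoint re)]|]; rewrite ?subr0.
Qed.

Lemma degreeE (R : realType) (D : diagram R) c : degree D c =
  \sum_(e \in crossings (curve D)) chord_term D c (fun=> 1 : int) (fun=> 1 : int) e.
Proof.
by rewrite -chord_sumE; congr (_ - _); apply: eq_fsbigr => e _; rewrite intz.
Qed.

(** The condition on the weights fits both uses: constant weights for the degree, and v^d(e),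
    v^(-d(e)) for the exponent, which are exchanged when e is switched because d(e) changes sign. *)
Lemma chord_term_swap (R : realType) (V : zmodType) (D D' : diagram R) c e
    (F F' G G' : R * R -> V) :
  curve D = curve D' -> crossings (curve D) e ->
  first_over D c = first_over D' c ->
  (if first_over D e == first_over D' e then F' e = F e /\ G' e = G e
   else F' e = G e /\ G' e = F e) ->
  chord_term D' c F' G' e = chord_term D c F G e.
Proof.
move=> eq_curve eD eq_c; rewrite /chord_term.
have sR t := (sides_same t eq_c).1; have sL t := (sides_same t eq_c).2.
rewrite !sR !sL; case: eqP => [eq_e [-> ->]|/eqP neq_e [-> ->]].
  rewrite -!(over_under_same eq_e).1 -!(over_under_same eq_e).2.
  by rewrite (sgn_same eq_curve eq_e).
rewrite -!(over_under_swap neq_e).1 -!(over_under_swap neq_e).2.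
rewrite (sgn_swap eq_curve eD neq_e) !mulrNz opprK.
rewrite ![right_of _ _ _ && _]andbC.
(* The two tests now come in the opposite order; since they exclude each other, the order is
   immaterial. *)
case: ifP => // /andP[Lu Ro]; case: ifP => // /andP[Lo _].
by case: (left_right_disjoint Lo Ro).
Qed.

(** Reversing c exchanges its two sides. With the same weight on both sides, as in the degree, this
    amounts to a change of sign. *)
Lemma chord_term_opp (R : realType) (V : zmodType) (D D' : diagram R) c e
    (F : R * R -> V) :
  curve D = curve D' -> crossings (curve D) c -> crossings (curve D) e ->
  first_over D c != first_over D' c ->
  chord_term D' c F F e = - chord_term D c F F e.
Proof.
move=> eq_curve cD eD neq_c; rewrite /chord_term.
have sR t := (sides_swap t cD neq_c).1; have sL t := (sides_swap t cD neq_c).2.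
rewrite !sR !sL; case: (eqVneq (first_over D e) (first_over D' e)) => [eq_e|neq_e].
  rewrite -!(over_under_same eq_e).1 -!(over_under_same eq_e).2.
  rewrite (sgn_same eq_curve eq_e).
  case: ifP => [/andP[Ro _]|_]; last by case: ifP; rewrite ?oppr0.
  by case: ifP => [/andP[/left_right_disjoint/(_ Ro)]|_]; rewrite ?opprK.
rewrite -!(over_under_swap neq_e).1 -!(over_under_swap neq_e).2.
rewrite (sgn_swap eq_curve eD neq_e) !mulrNz opprK.
rewrite ![right_of _ _ _ && _]andbC.
by case: ifP => // _; case: ifP; rewrite ?opprK ?oppr0.
Qed.

Lemma fsumrN (T : choiceType) (V : zmodType) (X : set T) (F : T -> V) :
  finite_set X -> \sum_(x \in X) - F x = - \sum_(x \in X) F x.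
Proof. by move=> finX; rewrite !fsbig_finite// sumrN. Qed.

Lemma degree_swap (R : realType) (D D' : diagram R) c :
  curve D = curve D' -> crossings (curve D) c ->
  degree D' c =
  if first_over D c == first_over D' c then degree D c else - degree D c.
Proof.
move=> eq_curve cD; rewrite !degreeE -eq_curve.
have finX := immersion_finite (curve_generic D).
case: eqP => [eq_c|/eqP neq_c].
  apply: eq_fsbigr => e; rewrite inE => eD.
  by apply: chord_term_swap => //; case: ifP.
rewrite -fsumrN//; apply: eq_fsbigr => e; rewrite inE => eD.
exact: chord_term_opp.
Qed.

(** The modulus m is a free parameter, so that the exponents of two diagrams can be compared in one
    ring before their degrees are identified. *)
Definition chord_exponent (R : realType) (D : diagram R) (c : R * R) (m : nat) : Rm m :=
  \sum_(e \in crossings (curve D))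
    chord_term D c (fun e => vpow m (degree D e %% m)%Z)
                   (fun e => vpow m (- degree D e %% m)%Z) e.

Lemma gE (R : realType) (D : diagram R) c :
  g D c = chord_exponent D c `|degree D c|.
Proof. by rewrite /g chord_sumE. Qed.

Lemma chord_exponent_swap (R : realType) (D D' : diagram R) c m :
  curve D = curve D' -> first_over D c = first_over D' c ->
  chord_exponent D' c m = chord_exponent D c m.
Proof.
move=> eq_curve eq_c; rewrite /chord_exponent -eq_curve.
apply: eq_fsbigr => e; rewrite inE => eD; apply: chord_term_swap => //.
by rewrite (degree_swap eq_curve eD); case: ifP => ->; rewrite ?opprK.
Qed.

Lemma exponent_local (R : realType) (D D' : diagram R) c :
  curve D = curve D' -> crossings (curve D) c ->
  first_over D c = first_over D' c -> Tagged Rm (g D' c) = Tagged Rm (g D c).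
Proof.
move=> eq_curve cD eq_c; rewrite !gE (degree_swap eq_curve cD) eq_c eqxx.
by rewrite (chord_exponent_swap _ eq_curve eq_c).
Qed.

(** * B as a sum of local contributions, and their jumps *)

Lemma uniform_nonsingular (R : realType) (gamma : R -> R * R)
    (G : generic_immersion gamma) (b : bool) c :
  crossings gamma c ->
  (fun=> if b then FirstOver else SecondOver) c <> Singular.
Proof. by case: b. Qed.

Definition uniform_diagram (R : realType) (gamma : R -> R * R)
    (G : generic_immersion gamma) (b : bool) : diagram R :=
  @Diagram R (SingularDiagram (fun=> if b then FirstOver else SecondOver) G)
    (@uniform_nonsingular R gamma G b).

(* By [exponent_local], the uniform diagram may stand for any diagram on the
   same curve with the information b at c. *)
Definition crossing_value (R : realType) (gamma : R -> R * R)
    (G : generic_immersion gamma) (b : bool) (c : R * R) : value_group :=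
  << u gamma c *g Tagged Rm (g (uniform_diagram G b) c) >>.

Definition sum_value (R : realType) (gamma : R -> R * R)
    (G : generic_immersion gamma) (o : R * R -> bool) : value_group :=
  \sum_(c \in crossings gamma) crossing_value G (o c) c.

Lemma B_sum_value (R : realType) (D : diagram R) :
  B D = sum_value (curve_generic D) (first_over D).
Proof.
rewrite /B /sum_value; apply: eq_fsbigr => c; rewrite inE => cD.
rewrite /crossing_value (exponent_local (D := D)) //.
by rewrite /first_over /=; case: (kind D c).
Qed.

Lemma fsum_change (T : choiceType) (V : zmodType) (X : set T) c (F F' : T -> V) :
  finite_set X -> X c -> (forall e, e != c -> F e = F' e) ->
  \sum_(e \in X) F e - \sum_(e \in X) F' e = F c - F' c.
Proof.
move=> finX Xc eqF; rewrite (fsbigD1 c)// [X in _ - X](fsbigD1 c)//.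
rewrite (eq_fsbigr F') /=; first by rewrite opprD addrACA subrr addr0.
by move=> e; rewrite inE => -[_ /eqP]; exact: eqF.
Qed.

(** Here b is the information that makes c positive, so this is the contribution of c in D(c+) minus
    that in D(c-). *)
Definition crossing_jump (R : realType) (gamma : R -> R * R)
    (G : generic_immersion gamma) (c : R * R) : value_group :=
  let b := 0 < det (velocity gamma c.1) (velocity gamma c.2) in
  crossing_value G b c - crossing_value G (~~ b) c.

Lemma sum_value_jump (R : realType) (S : singular_diagram R) c :
  crossings (curve S) c ->
  sum_value (curve_generic S) (first_over (resolve S c true)) -
  sum_value (curve_generic S) (first_over (resolve S c false)) =
  crossing_jump (curve_generic S) c.
Proof.
move=> cS; set b := 0 < det (velocity (curve S) c.1) (velocity (curve S) c.2).
have first_c s : first_over (resolve S c s) c = (b == s).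
  by rewrite /first_over /resolve /= eqxx -/b; case: (b == s).
rewrite /sum_value (fsum_change (immersion_finite (curve_generic S)) cS).
  by rewrite !first_c eqb_id eqbF_neg.
by move=> e /negbTE ec; rewrite /first_over /resolve /= ec.
Qed.

(** * The extension of B to singular diagrams *)

(* J c, the effect of a crossing change at c, depends on the curve alone, so
   that the skein relation gives 0 beyond one singular crossing; s lists the
   singular crossings. *)
Definition order_one_value (T : Type) (V : zmodType) (a : V) (J : T -> V)
    (s : seq T) : V :=
  match s with [::] => a | [:: c] => J c | _ => 0 end.

(** With one singular crossing this is the hypothesis on a1 - a2. With two, both resolutions keep
    the same remaining crossing and hence the same jump, which cancels. With more, all values are
    0. *)
Lemma order_one_value_skein (T : eqType) (V : zmodType) (a a1 a2 : V) (J : T -> V)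
    (c : T) (s s' : seq T) :
  c \in s -> size s = (size s').+1 -> a1 - a2 = J c ->
  order_one_value a J s = order_one_value a1 J s' - order_one_value a2 J s'.
Proof.
case: s => [//|c1 [|c2 s]]; case: s' => [|c3 [|c4 s']] //=; rewrite ?subrr //.
by rewrite inE => /eqP <- _.
Qed.

Definition B_extension (R : realType) (S : singular_diagram R) : value_group :=
  order_one_value (sum_value (curve_generic S) (first_over S))
    (crossing_jump (curve_generic S)) (fset_set (singular_crossings S)).

Lemma finite_singular_crossings (R : realType) (S : singular_diagram R) :
  finite_set (singular_crossings S).
Proof.
by apply: sub_finite_set (immersion_finite (curve_generic S)) => c [].
Qed.

Lemma singular_crossings_resolve (R : realType) (S : singular_diagram R) c s :
  singular_crossings (resolve S c s) = singular_crossings S `\ c.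
Proof.
apply/seteqP; split => e /=.
  case=> /= eS; case: eqP => [_|ec ke]; first by case: (_ == s).
  by split.
by case=> -[eS ke] /eqP/negbTE ec; split => //=; rewrite ec.
Qed.

Lemma B_extension_resolve (R : realType) (S : singular_diagram R) c :
  singular_crossings S c ->
  B_extension S = B_extension (resolve S c true) - B_extension (resolve S c false).
Proof.
move=> cS; have finS := finite_singular_crossings S.
have cl : c \in fset_set (singular_crossings S) by rewrite in_fset_set// inE.
rewrite /B_extension !singular_crossings_resolve fset_setD1//.
apply: (@order_one_value_skein _ _ _ _ _ _ c);
  [exact: cl | | exact: sum_value_jump cS.1].
by rewrite -[LHS]/#|` _| (cardfsD1 c) cl.
Qed.

(** * A polynomial curve with two crossings *)

(* In the parameter w = 32 t - 17, which runs over [-17, 15], the curve is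
   (w^3 - 196 w, w^4 - 356 w^2).  A double point (w, z) satisfies
   w^2 + w z + z^2 = 196 and (w + z) (w^2 + z^2 - 356) = 0, that is
   {w, z} = {-14, 14}, {-16, 10} or {-10, 16}; the last one is cut off. *)
Definition example_param (R : realType) : {poly R} := 32%:P * 'X - 17%:P.
Definition example_x (R : realType) : {poly R} :=
  example_param R ^+ 3 - 196%:P * example_param R.
Definition example_y (R : realType) : {poly R} :=
  example_param R ^+ 4 - 356%:P * example_param R ^+ 2.
Definition example_curve (R : realType) (t : R) : R * R :=
  ((example_x R).[t], (example_y R).[t]).

Lemma example_curveE (R : realType) (t w : R) : w = 32 * t - 17 ->
  example_curve t = (w ^+ 3 - 196 * w, w ^+ 4 - 356 * w ^+ 2).
Proof.
by move=> ->; rewrite /example_curve /example_x /example_y /example_param !hornerE.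
Qed.

Lemma example_velocityE (R : realType) (t w : R) : w = 32 * t - 17 ->
  velocity (@example_curve R) t =
  (32 * (3 * w ^+ 2 - 196), 32 * (4 * w ^+ 3 - 712 * w)).
Proof.
move=> ->; rewrite /velocity.
have -> : fst \o @example_curve R = horner (example_x R) by [].
have -> : snd \o @example_curve R = horner (example_y R) by [].
rewrite -!derivE /example_x /example_y /example_param.
rewrite !(derivB, derivM, derivX, deriv_exp, derivC, hornerE) /=.
by congr pair; ring.
Qed.

Lemma derivable_derive1n_horner (R : realType) (p : {poly R}) n (t : R) :
  derivable (derive1n n (horner p)) t 1.
Proof.
suff -> : derive1n n (horner p) = horner (derivn n p) by exact: derivable_horner.
by elim: n => [//|n IHn]; rewrite derivnS derivE -IHn.
Qed.

Lemma example_passage (R : realType) (p q : R) :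
  passage (@example_curve R) p q ->
  (p, q) \in [:: (1 / 32, 27 / 32); (27 / 32, 1 / 32);
                 (3 / 32, 31 / 32); (31 / 32, 3 / 32)].
Proof.
case=> /andP[p0 p1] /andP[q0 q1] pq.
rewrite (example_curveE (erefl (32 * p - 17))) (example_curveE (erefl (32 * q - 17))).
set w := 32 * p - 17; set z := 32 * q - 17 => -[ex ey].
have pE : p = (w + 17) / 32 by rewrite /w; field.
have qE : q = (z + 17) / 32 by rewrite /z; field.
have wz : w - z != 0.
  by apply: contra pq => /eqP; rewrite /w /z => ?; apply/eqP; lra.
have e1 : w ^+ 2 + w * z + z ^+ 2 = 196.
  by apply: (mulfI wz); lra.
have e2 : (w + z) * (w ^+ 2 + z ^+ 2 - 356) = 0.
  by apply: (mulfI wz); lra.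
have [w1 w2 z1 z2] : [/\ -17 <= w, w <= 15, -17 <= z & z <= 15].
  by rewrite /w /z; split; lra.
move/eqP: e2; rewrite mulf_eq0 => /orP[/eqP zw|/eqP e2].
  have {}zw : z = - w by lra.
  have /eqP : (w - 14) * (w + 14) = 0 by move: e1; rewrite zw => e1; lra.
  rewrite mulf_eq0 => /orP[] /eqP wE.
    have -> : (p, q) = (31 / 32, 3 / 32) by congr pair; lra.
    by rewrite !inE eqxx !orbT.
  have -> : (p, q) = (3 / 32, 31 / 32) by congr pair; lra.
  by rewrite !inE eqxx !orbT.
(* Twice the first equation minus the second gives (w + z)^2 = 392 - 356 = 36. *)
have /eqP : (w + z - 6) * (w + z + 6) = 0 by lra.
rewrite mulf_eq0 => /orP[] /eqP zw.
  have {}zw : z = 6 - w by lra.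
  have /eqP : (w - 16) * (w + 10) = 0 by move: e1; rewrite zw => e1; lra.
  by rewrite mulf_eq0 => /orP[] /eqP wE; lra.
have {}zw : z = - 6 - w by lra.
have /eqP : (w + 16) * (w - 10) = 0 by move: e1; rewrite zw => e1; lra.
rewrite mulf_eq0 => /orP[] /eqP wE.
  have -> : (p, q) = (1 / 32, 27 / 32) by congr pair; lra.
  by rewrite !inE eqxx.
have -> : (p, q) = (27 / 32, 1 / 32) by congr pair; lra.
by rewrite !inE eqxx !orbT.
Qed.

Definition example_c (R : realType) : R * R := (1 / 32, 27 / 32).
Definition example_e (R : realType) : R * R := (3 / 32, 31 / 32).

Lemma example_passage_c (R : realType) :
  passage (@example_curve R) (1 / 32) (27 / 32).
Proof.
rewrite /passage (@example_curveE R (1 / 32) (-16)) ?(@example_curveE R (27 / 32) 10);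
  try by field.
by split; [lra | lra | apply/eqP; lra | congr pair; ring].
Qed.

Lemma example_passage_e (R : realType) :
  passage (@example_curve R) (3 / 32) (31 / 32).
Proof.
rewrite /passage (@example_curveE R (3 / 32) (-14)) ?(@example_curveE R (31 / 32) 14);
  try by field.
by split; [lra | lra | apply/eqP; lra | congr pair; ring].
Qed.

Lemma example_crossings (R : realType) :
  crossings (@example_curve R) = [set example_c R] `|` [set example_e R].
Proof.
apply/seteqP; split => [[p q] [/example_passage] |[p q] /= [] [-> ->]] /=.
- by rewrite !inE => /or4P[] /eqP[-> ->] ?;
    [left | exfalso; lra | right | exfalso; lra].
- by split => /=; [exact: example_passage_c | lra].
- by split => /=; [exact: example_passage_e | lra].
Qed.

Lemma example_det (R : realType) (s t w z : R) :
  w = 32 * s - 17 -> z = 32 * t - 17 ->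
  det (velocity (@example_curve R) s) (velocity (@example_curve R) t) =
  1024 * ((3 * w ^+ 2 - 196) * (4 * z ^+ 3 - 712 * z) -
          (4 * w ^+ 3 - 712 * w) * (3 * z ^+ 2 - 196)).
Proof.
by move=> /example_velocityE -> /example_velocityE ->; rewrite /det /=; ring.
Qed.

Lemma example_det_c (R : realType) :
  det (velocity (@example_curve R) (1 / 32)) (velocity (@example_curve R) (27 / 32))
  < 0.
Proof. by rewrite (@example_det R _ _ (-16) 10); [lra|field|field]. Qed.

Lemma example_det_e (R : realType) :
  0 <
  det (velocity (@example_curve R) (3 / 32)) (velocity (@example_curve R) (31 / 32)).
Proof. by rewrite (@example_det R _ _ (-14) 14); [lra|field|field]. Qed.

Lemma example_generic (R : realType) : generic_immersion (@example_curve R).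
Proof.
split.
- by move=> n t; split; exact: derivable_derive1n_horner.
- move=> t _; rewrite (example_velocityE (erefl (32 * t - 17))).
  set w := 32 * t - 17; apply/eqP => -[ex ey].
  have e1 : 3 * w ^+ 2 = 196 by lra.
  (* The critical points of the second coordinate are w = 0 and w^2 = 178; neither satisfies 3 w^2 =
     196. *)
  have /eqP : w * (w ^+ 2 - 178) = 0 by lra.
  rewrite mulf_eq0 => /orP[] /eqP wE; last by lra.
  by move: e1; rewrite wE; lra.
- by rewrite example_crossings finite_setU; split; exact: finite_set1.
- move=> p q q' /example_passage + /example_passage.
  by rewrite !inE => /or4P[] /eqP[-> ->] /or4P[] /eqP[] // *; lra.
- move=> p q /example_passage; have := example_det_c R; have := example_det_e R.
  rewrite !inE => de dc /or4P[] /eqP[-> ->].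
  + by rewrite lt_eqF.
  + by rewrite det_antisym oppr_eq0 lt_eqF.
  + by rewrite gt_eqF.
  + by rewrite det_antisym oppr_eq0 gt_eqF.
- by move=> p q /example_passage; rewrite !inE => /or4P[] /eqP[-> _]; lra.
Qed.

(** * The jump of B at a crossing of the example *)

(** From its first arrival at c to its second, the curve passes once through c (+1) and once through
    e (-1), so both arriving arcs have the same label. *)
Lemma example_u (R : realType) : u (@example_curve R) (example_c R) = 1.
Proof.
have tc : turn (@example_curve R) (1 / 32) (27 / 32) = 1.
  by rewrite /turn det_antisym oppr_gt0 example_det_c.
have tc' : turn (@example_curve R) (27 / 32) (1 / 32) = -1.
  by rewrite /turn lt_gtF// example_det_c.
have te : turn (@example_curve R) (3 / 32) (31 / 32) = -1.
  by rewrite /turn det_antisym oppr_gt0 lt_gtF// example_det_e.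
suff kE : coloring (@example_curve R) (27 / 32) = coloring (@example_curve R) (1 / 32).
  by rewrite /u /= tc /= tc' kE; ring.
(* Were there no Cheng coloring, the default labelling would be constant. *)
rewrite /coloring; case: xgetP => // k _ [_ kS].
have -> : k (27 / 32) = k (3 / 32) + turn (@example_curve R) (3 / 32) (31 / 32).
  apply: kS (example_passage_e R) _ _ _; try lra.
  by move=> p q /example_passage; rewrite !inE => /or4P[] /eqP[-> _]; lra.
have -> : k (3 / 32) = k (1 / 32) + turn (@example_curve R) (1 / 32) (27 / 32).
  apply: kS (example_passage_c R) _ _ _; try lra.
  by move=> p q /example_passage; rewrite !inE => /or4P[] /eqP[-> _]; lra.
by rewrite tc te; ring.
Qed.

(** The chord c does not cross itself. The chord e points to the left of c for both values of b,
    since c and e are reversed together; its sign is +1 if b holds and -1 otherwise. *)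
Lemma example_chord_sum (R : realType) (V : zmodType) b (F G : R * R -> V) :
  \sum_(e \in crossings (@example_curve R))
    chord_term (uniform_diagram (example_generic R) b) (example_c R) F G e =
  if b then - G (example_e R) else G (example_e R).
Proof.
rewrite example_crossings fsbigU0 ?fsbig_set1; try exact: finite_set1.
  rewrite /chord_term /left_of /right_of /sgn !over_parE !under_parE.
  rewrite /first_over /example_c /example_e /=.
  case: b => /=.
    rewrite example_det_e.
    by do ?[case: ltP => /= ?; try by exfalso; lra]; rewrite add0r.
  have -> : (0 < det (velocity (@example_curve R) (31 / 32))
                     (velocity (@example_curve R) (3 / 32))) = false.
    by rewrite det_antisym oppr_gt0 (lt_gtF (example_det_e R)).
  by do ?[case: ltP => /= ?; try by exfalso; lra]; rewrite add0r mulrNz opprK.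
by move=> x [-> []]; lra.
Qed.

Lemma example_degree (R : realType) b :
  degree (uniform_diagram (example_generic R) b) (example_c R) =
  if b then -1 else 1.
Proof. by rewrite degreeE example_chord_sum. Qed.

(** Evaluation at v = w = 1 kills both generators of the ideal but sends 1 - (-1) to 2. *)
Lemma Rm_sign_neq (m : nat) : (1 : Rm m) != -1.
Proof.
rewrite -(rmorph1 (\pi_(Rm m)%qT)) -rmorphN.
apply/negP; rewrite -(@Quotient.idealrBE _ (Rm_idealr m)).
case/asboolP => q [r] /(congr1 (fun p : {poly {poly int}} => p.[1].[1])).
by rewrite !(hornerE, expr1n, subrr, mulr0, addr0).
Qed.

Lemma vpow0 (m : nat) : vpow m 0 = 1.
Proof.
have -> : vpow m 0 = \pi_(Rm m)%qT ('X%:P ^+ 0) by [].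
by rewrite expr0 rmorph1.
Qed.

Lemma example_exponent (R : realType) b :
  Tagged Rm (g (uniform_diagram (example_generic R) b) (example_c R)) =
  Tagged Rm (if b then -1 else 1 : Rm 1).
Proof.
rewrite gE example_degree.
have -> : absz (if b then -1 else 1) = 1%N by case: b.
(* Modulo 1 every exponent of v becomes 0, whatever the degree of e. *)
rewrite /chord_exponent example_chord_sum modz1 vpow0.
by case: b.
Qed.

Lemma example_jump (R : realType) :
  crossing_jump (example_generic R) (example_c R) <> 0.
Proof.
rewrite /crossing_jump /crossing_value example_u !example_exponent.
rewrite [0 < _]lt_gtF ?example_det_c //=.
(* The determinant at c is negative, so the positive resolution has b false and exponent 1. The
   coefficient of x^1 in the jump is therefore u(c) = 1, the other symbol being x^(-1). *)
move=> /(congr1 (coeff (Tagged Rm (1 : Rm 1)))).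
rewrite coeffB !coeffU coeff0 eqxx.
by rewrite eq_Tagged eq_sym (negbTE (Rm_sign_neq 1)).
Qed.

Definition example_diagram (R : realType) : singular_diagram R :=
  SingularDiagram (fun c => if c == example_c R then Singular else FirstOver)
    (example_generic R).

Lemma example_singular_crossings (R : realType) :
  singular_crossings (example_diagram R) = [set example_c R].
Proof.
apply/seteqP; split => c /=; first by case=> _ /=; case: eqP.
by move=> ->; split; rewrite /= ?example_crossings ?eqxx //; left.
Qed.

Lemma B_extension_nonsingular (R : realType) (D : diagram R) :
  B_extension D = B D.
Proof.
rewrite B_sum_value /B_extension.
have -> : singular_crossings D = set0.
  by apply/seteqP; split => // c [/diagram_nonsingular].
by rewrite fset_set0.
Qed.

Theorem theorem4p4 (R : realType) (nu : knotoid R -> value_group)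
    (nu_B : forall D : diagram R, nu (\pi_(knotoid R)%qT D) = B D) :
  vassiliev_of_order nu 1.
Proof.
exists (@B_extension R).
  split=> [D|D c]; first by rewrite nu_B B_extension_nonsingular.
  exact: B_extension_resolve.
split.
  exists (\pi_(singular_knotoid R)%qT (example_diagram R)), (example_diagram R).
  split=> //.
    by rewrite /nb_singular example_singular_crossings fset_set1 cardfs1.
  rewrite /B_extension example_singular_crossings fset_set1 -fset_seq1.
  exact: example_jump.
move=> _ D _; rewrite /nb_singular /B_extension.
(* With at least two singular crossings listed, [order_one_value] is 0 by definition. *)
by case: (enum_fset _) => [|c1 [|c2 l]].
Qed.
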